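(* Let $A$ be an integral domain and $E$ a multiplication $A$-module. Then $E$ is a uniserial module if and only if $qD_A(E)$ is a nested topology.
   Context: For an $A$-module $E$: $\operatorname{ann}(E)=\{a\in A: aE=0\}$, $W(E)=\{a\in A: aE\neq E\}$, $W(E)^{\#}=W(E)\setminus\operatorname{ann}(E)$. On $W(E)^{\#}$ put $a\sim b$ iff $aE=bE$; $[a]$ is the class of $a$ and $\operatorname{EC}(W(E)^{\#})$ is the set of all classes. For $a\in W(E)^{\#}$, $U_a=\{[b]\in\operatorname{EC}(W(E)^{\#}): aE\subseteq bE\}$. The quasi divisor topology $qD_A(E)$ is the topological space $\operatorname{EC}(W(E)^{\#})$ whose topology has basis $\{U_a\}_{a\in W(E)^{\#}}$. $E$ is a multiplication module if every submodule of $E$ has the form $IE$ for some ideal $I$ of $A$. $E$ is uniserial if any two submodules of $E$ are comparable under inclusion. A topology is nested if its open sets are linearly ordered by inclusion. *)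

(* Defs.v *)
From HB Require Import structures.
From mathcomp Require Import all_boot all_order all_algebra generic_quotient.
From mathcomp Require Import boolp classical_sets topology.

Set Implicit Arguments.
Unset Strict Implicit.
Unset Printing Implicit Defensive.

Import GRing.Theory.

Local Open Scope ring_scope.
Local Open Scope classical_set_scope.
Local Open Scope quotient_scope.

Section Modules.
Variables (A : comNzRingType) (E : lmodType A).

Definition submodule (N : set E) : Prop := GRing.submod_closed (mem N).

(* Improper ideals are allowed, unlike with the library's [idealr_closed],
   hence the phrasing as submodules of the regular module. *)
Definition ideal (I : set A) : Prop :=
  @GRing.submod_closed A A^o (mem (I : set A^o)).

(* The submodule I E generated by the products a *: e with a in I. *)
Definition ideal_mul (I : set A) : set E :=
  [set x | exists (n : nat) (a : 'I_n -> A) (e : 'I_n -> E),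
     (forall i, I (a i)) /\ x = \sum_(i < n) a i *: e i].

Definition scalar_mul (a : A) : set E := [set a *: e | e in setT].

Definition ann : set A := [set a | scalar_mul a = [set 0]].

Definition W : set A := [set a | scalar_mul a <> setT].

Definition Wsharp : set A := W `\` ann.

Definition multiplication_module : Prop :=
  forall N : set E, submodule N ->
    exists2 I : set A, ideal I & N = ideal_mul I.

Definition uniserial : Prop :=
  forall N K : set E, submodule N -> submodule K -> N `<=` K \/ K `<=` N.

Definition same_mul (a b : Wsharp) : bool :=
  `[< scalar_mul (val a) = scalar_mul (val b) >].

Lemma same_mul_refl : reflexive same_mul.
Proof. by move=> a; apply/asboolP. Qed.

Lemma same_mul_sym : symmetric same_mul.
Proof. by move=> a b; apply/asboolP/asboolP => ->. Qed.

Lemma same_mul_trans : transitive same_mul.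
Proof. by move=> b a c /asboolP ab /asboolP bc; apply/asboolP; rewrite ab. Qed.

Canonical same_mul_equiv :=
  EquivRel same_mul same_mul_refl same_mul_sym same_mul_trans.

Definition EC : Type := {eq_quot same_mul_equiv}.

HB.instance Definition _ := Choice.on EC.

Definition class_of (a : Wsharp) : EC := \pi_{eq_quot same_mul_equiv} a.

Lemma class_of_eq (a b : Wsharp) :
  class_of a = class_of b <-> scalar_mul (val a) = scalar_mul (val b).
Proof.
split=> [/eqquotP /asboolP //|ab].
by apply/eqquotP/asboolP.
Qed.

Lemma class_of_surj (x : EC) : exists a, x = class_of a.
Proof. by exists (repr x); rewrite /class_of reprK. Qed.

Definition U (a : Wsharp) : set EC :=
  [set class_of b | b in [set b | scalar_mul (val a) `<=` scalar_mul (val b)]].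

Lemma UE (a b : Wsharp) :
  U a (class_of b) <-> scalar_mul (val a) `<=` scalar_mul (val b).
Proof.
split=> [[c /= ac /class_of_eq <- //]|ab]; by exists b.
Qed.

Definition basicU : set (set EC) := range U.

Lemma basicU_cover : \bigcup_(V in basicU) V = setT.
Proof.
rewrite -subTset => x _; have [a ->] := class_of_surj x.
by exists (U a); [exists a | apply/UE].
Qed.

Lemma basicU_join (V V' : set EC) (x : EC) :
    basicU V -> basicU V' -> V x -> V' x ->
  exists V'', [/\ basicU V'', V'' x & V'' `<=` V `&` V'].
Proof.
move=> [a _ <-] [b _ <-]; have [c ->] := class_of_surj x.
move=> /UE ac /UE bc; exists (U c); split; [by exists c | exact/UE | ].
by move=> _ [d /= cd <-]; split; apply/UE;
  [exact: subset_trans ac cd | exact: subset_trans bc cd].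
Qed.

Definition qD : Type := EC.

HB.instance Definition _ := Choice.on qD.
HB.instance Definition _ :=
  @isBaseTopological.Build qD (set EC) basicU id basicU_cover basicU_join.

Lemma qD_openE (V : set qD) :
  open V <-> exists2 D, D `<=` basicU & V = \bigcup_(X in D) X.
Proof.
by split=> [[D s <-]|[D s ->]]; exists D.
Qed.

Lemma qD_basis : basis (basicU : set (set qD)).
Proof.
split=> [V BV|x V].
  by apply/qD_openE; exists [set V]; [move=> _ -> | rewrite bigcup_set1].
rewrite nbhsE => -[O [[D s <-]] [X DX Xx] OV].
exists X; first by split => //; exact: s.
by move=> y Xy; apply: OV; exists X.
Qed.

End Modules.

Definition nested (T : topologicalType) : Prop :=
  forall V V' : set T, open V -> open V' -> V `<=` V' \/ V' `<=` V.

(* Main.v *)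
Require Import Defs.
From mathcomp Require Import all_boot all_order all_algebra.
From mathcomp Require Import boolp classical_sets topology.

(** Both properties are equivalent to the comparability, for inclusion, of the
    submodules [a E] for [a] in [A].

    On the topological side, the opens of [qD E] are up-sets: the class of [b]
    has a least open neighbourhood [U b], and [U a `<=` U b] means
    [b E `<=` a E].  The up-sets of a preorder form a chain exactly when the
    preorder is total ([nested_qD_iff]).  Only the scalars in [W(E)^#] occur in
    [qD E], but the remaining ones have [a E = 0] or [a E = E], which are
    comparable with everything.

    On the module side, every submodule is some [I E], that is, the submodule
    generated by the [a E] with [a] in [I].  Sums of members of a chain are
    again pairwise comparable: if some [a E] with [a] in [I] is not inside
    [J E], it is inside no [b E] with [b] in [J], so it contains all of them
    ([uniserial_iff]). *)

Import GRing.Theory.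

Local Open Scope ring_scope.
Local Open Scope classical_set_scope.

Section ScalarMultiples.
Set Implicit Arguments.
Unset Strict Implicit.
Variables (A : comNzRingType) (E : lmodType A).

Local Notation smul := (@scalar_mul A E).

Lemma submodule_scalar_mul (a : A) : submodule (smul a).
Proof.
split; first by apply/mem_set; exists 0; rewrite ?scaler0.
move=> c x y /set_mem [u _ <-] /set_mem [v _ <-]; apply/mem_set.
by exists (c *: u + v) => //; rewrite scalerDr !scalerA mulrC.
Qed.

Lemma scalar_mul_sub_ideal_mul (I : set A) (a : A) :
  I a -> smul a `<=` ideal_mul I.
Proof.
move=> Ia _ [e _ <-]; exists 1%N, (fun=> a), (fun=> e); split => //.
by rewrite big_ord1.
Qed.

Lemma ideal_mul_sub (I : set A) (N : set E) : submodule N ->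
  (forall a, I a -> smul a `<=` N) -> ideal_mul I `<=` N.
Proof.
move=> [N0 Nlin] IN _ [n [a [e [Ia ->]]]]; apply: set_mem.
elim/big_ind: _ => // [x y Nx Ny|i _]; first by rewrite -[x]scale1r Nlin.
by apply/mem_set/(IN (a i)) => //; exists (e i).
Qed.

Definition scalar_mul_total : Prop := forall a b : A,
  smul a `<=` smul b \/ smul b `<=` smul a.

(** Each [a E] is itself a submodule, which gives one direction; in the other,
    writing both submodules as [I E] and [J E] reduces their comparison to that
    of the generating [a E], with the witness [a] of [~ I E `<=` J E] above
    every [b E] with [b] in [J]. *)
Lemma uniserial_iff : multiplication_module E ->
  uniserial E <-> scalar_mul_total.
Proof.
move=> multE; split=> [unE a b|tot N K subN subK].
  by apply: unE; exact: submodule_scalar_mul.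
have [I _ NI] := multE _ subN; have [J _ KJ] := multE _ subK.
have [IK|] := pselect (forall a, I a -> smul a `<=` K).
  by left; rewrite NI; exact: ideal_mul_sub.
move=> /existsNP [a /not_implyP [Ia aK]]; right; rewrite KJ.
apply: ideal_mul_sub => // b Jb.
have [ab|ba] := tot a b.
  by case: aK; rewrite KJ; apply: subset_trans ab (scalar_mul_sub_ideal_mul _).
by rewrite NI; apply: subset_trans ba (scalar_mul_sub_ideal_mul _).
Qed.

Lemma open_U (a : Wsharp E) : open (U a : set (qD E)).
Proof. by have [+ _] := qD_basis E; apply; exists a. Qed.

(** A basic open [U b] containing the class of [a] contains [U a], by
    transitivity of inclusion: [U a] is the least open neighbourhood of that
    class. *)
Lemma open_qD_up (V : set (qD E)) (a : Wsharp E) :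
  open V -> V (class_of a) -> U a `<=` V.
Proof.
move=> /qD_openE [D DU ->] [X DX Xa] _ [c /= ac <-]; exists X => //.
have [b _ bX] := DU _ DX; rewrite -bX in Xa *.
by apply/UE; apply: subset_trans ac; apply/UE.
Qed.

(** From nested opens, compare [U a] and [U b] at the classes of [a] and [b].
    Conversely, a point [x] of [V] outside [V'] lies below every point of [V'],
    since otherwise [V'], being an up-set, would contain it; so the up-set [V]
    contains [V']. *)
Lemma nested_qD_iff : nested (qD E) <-> scalar_mul_total.
Proof.
split=> [nestE a b|tot V V' oV oV'].
  (* A scalar outside [W(E)^#] multiplies [E] onto [0] or onto [E]. *)
  have trivial (c : A) : ~ Wsharp E c ->
      smul c = [set 0] \/ smul c = setT.
    move=> /not_andP [/contrapT|/contrapT]; first by right.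
    by left.
  have sub0 (c : A) : [set 0] `<=` smul c.
    by move=> _ ->; exists 0; rewrite ?scaler0.
  have [Wa|/trivial [->|->]] := pselect (Wsharp E a); [|by left|by right].
  have [Wb|/trivial [->|->]] := pselect (Wsharp E b); [|by right|by left].
  pose a' : Wsharp E := exist _ a (mem_set Wa).
  pose b' : Wsharp E := exist _ b (mem_set Wb).
  have [ab|ba] := nestE _ _ (open_U a') (open_U b').
    by right; apply/(UE b' a')/ab/UE.
  by left; apply/(UE a' b')/ba/UE.
have [|/existsNP [x /not_implyP [Vx V'x]]] := pselect (V `<=` V').
  by left.
right=> y V'y; have [a xa] := class_of_surj x; have [b yb] := class_of_surj y.
rewrite {}xa in Vx V'x; rewrite {}yb in V'y *.
have [ab|ba] := tot (val a) (val b).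
  by apply: open_qD_up Vx _ _ => //; apply/UE.
by case: V'x; apply: open_qD_up V'y _ _ => //; apply/UE.
Qed.

End ScalarMultiples.

Theorem theorem2 (A : idomainType) (E : lmodType A)
    (hE : multiplication_module E) :
  uniserial E <-> nested (qD E).
Proof. by rewrite uniserial_iff // nested_qD_iff. Qed.
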